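(* Let $G$ be a group, $R$ an indecomposable commutative ring with unit and $\mathscr G$ a $G$-graded Hausdorff ample groupoid. Let $N$ be the graded normalizer of $D(\mathscr G)$ in $R\mathscr G$ and $\sim$ the congruence on $N$ given by $m\sim n$ if and only if $m'm=n'n$ and $mn'\in D(\mathscr G)$. The $G$-graded homomorphism $\psi\colon \Gamma_c^h(\mathscr G)\to N/{\sim}$ given by $\psi(U)=[\chi_U]$ (the class of the characteristic function of $U$) is injective. It is an isomorphism if and only if $\mathscr G$ satisfies the local bisection hypothesis (relative to $R$ and the grading).
   Context: A commutative ring $R$ with unit is indecomposable if $0\neq 1$ and $0,1$ are its only idempotents. Inverse semigroups. An inverse semigroup is a semigroup $S$ such that for each $s\in S$ there is a unique $s^*\in S$ with $ss^*s=s$ and $s^*ss^*=s^*$. A $G$-graded inverse semigroup is an inverse semigroup $S$ with zero together with a map $\theta\colon S\setminus\{0\}\to G$ such that $\theta(st)=\theta(s)\theta(t)$ whenever $st\neq 0$. A graded homomorphism is a zero-preserving homomorphism respecting the gradings. Groupoids. A groupoid $\mathscr G$ is a small category with all arrows invertible; $\mathscr G^{(0)}$ is the set of objects (identified with the identity arrows), $\mathscr G^{(1)}$ the set of arrows, $\boldsymbol d,\boldsymbol r$ the domain and range maps; $\alpha\beta$ is defined when $\boldsymbol d(\alpha)=\boldsymbol r(\beta)$. A topological groupoid has topologies making all structure maps continuous; it is étale if $\boldsymbol d$ is a local homeomorphism (then all structure maps are, and $\mathscr G^{(0)}$ is open in $\mathscr G^{(1)}$). A Boolean space is a Hausdorff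 space with a basis of compact open sets. An ample groupoid is an étale groupoid with $\mathscr G^{(0)}$ a Boolean space; it is Hausdorff if $\mathscr G^{(1)}$ is Hausdorff. A local bisection is an open subset $U\subseteq\mathscr G^{(1)}$ on which $\boldsymbol d$ and $\boldsymbol r$ are injective. Gradings. A $G$-graded groupoid is a topological groupoid with a continuous functor (cocycle) $c\colon\mathscr G\to G$, $G$ being a discrete one-object groupoid; $\mathscr G_g=c^{-1}(g)$. A local bisection is homogeneous if it is contained in some $\mathscr G_g$. $\Gamma_c^h(\mathscr G)$ is the inverse semigroup of homogeneous compact local bisections under $UV=\{\alpha\beta\mid\alpha\in U,\beta\in V,\ \boldsymbol d(\alpha)=\boldsymbol r(\beta)\}$ (inverse $U^{-1}=\{\gamma^{-1}\mid\gamma\in U\}$, zero $\emptyset$), graded by sending a non-empty $U\subseteq\mathscr G_g$ to $g$. Groupoid algebra. $R\mathscr G$ is the $R$-module of compactly supported locally constant functions $\mathscr G^{(1)}\to R$ with product $fg(\gamma)=\sum_{\boldsymbol d(\alpha)=\boldsymbol d(\gamma)}f(\gamma\alpha^{-1})g(\alpha)$. It is $G$-graded, the component $R\mathscr G_g$ consisting of the functions supported on $\mathscr G_g$. The diagonal subalgebra $D(\mathscr G)$ is the set of functions supported on $\mathscr G^{(0)}$. Normalizer. For $g\in G$ let $N_g$ be the set of $m\in R\mathscr G_g$ for which there is $m'\in R\mathscr G_{g^{-1}}$ with $mm'm=m$, $m'mm'=m'$ and $mD(\mathscr G)m'\cup m'D(\mathscr G)m\subseteq D(\mathscr G)$. The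 (graded) normalizer is $N=\bigcup_{g\in G}N_g$; it is a $G$-graded inverse semigroup under multiplication (non-zero elements of $N_g$ have degree $g$), in which $m'$ is the unique inverse of $m$. The relation $\sim$ is a congruence on $N$ respecting the grading (with $0$ alone in its class), so $N/{\sim}$ is a $G$-graded inverse semigroup. $\mathscr G$ satisfies the local bisection hypothesis (relative to $R$ and the grading) if $\mathrm{supp}(m)=\{\gamma\mid m(\gamma)\ne0\}$ is a local bisection for every $m\in N$. *)

(* Defs.v *)
From HB Require Import structures.
From mathcomp Require Import all_boot all_order all_algebra.
From mathcomp Require Import all_classical all_reals all_analysis.

Set Implicit Arguments.
Unset Strict Implicit.
Unset Printing Implicit Defensive.

Import GRing.Theory.

Local Open Scope classical_set_scope.
Local Open Scope ring_scope.

Definition indecomposable (R : comPzRingType) : Prop :=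
  (0 : R) <> 1 /\ forall e : R, e * e = e -> e = 0 \/ e = 1.

(** * Graded inverse semigroups *)

(* A multiplicative structure carried by a subset [elt] of a type [T].  The
   grading is a map on [elt] minus [zero]; the values of [mulS] and [deg]
   outside [elt], and the value of [deg] at [zero], are irrelevant. *)
Record gradedMagma (G : groupType) (T : Type) := GradedMagma {
  elt : set T;
  mulS : T -> T -> T;
  zeroS : T;
  deg : T -> G
}.

Record graded_inverse_semigroup (G : groupType) (T : Type)
    (S : gradedMagma G T) : Prop := {
  gis_zero : elt S (zeroS S);
  gis_mul : forall s t, elt S s -> elt S t -> elt S (mulS S s t);
  gis_mul0 : forall s, elt S s -> mulS S s (zeroS S) = zeroS S;
  gis_0mul : forall s, elt S s -> mulS S (zeroS S) s = zeroS S;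
  gis_assoc : forall s t u, elt S s -> elt S t -> elt S u ->
    mulS S s (mulS S t u) = mulS S (mulS S s t) u;
  gis_inverse : forall s, elt S s ->
    exists! t, [/\ elt S t, mulS S (mulS S s t) s = s
                 & mulS S (mulS S t s) t = t];
  gis_deg : forall s t, elt S s -> elt S t -> mulS S s t <> zeroS S ->
    deg S (mulS S s t) = (deg S s * deg S t)%g
}.

Record graded_hom (G : groupType) (T T' : Type) (S : gradedMagma G T)
    (S' : gradedMagma G T') (phi : T -> T') : Prop := {
  ghom_elt : forall s, elt S s -> elt S' (phi s);
  ghom_mul : forall s t, elt S s -> elt S t ->
    phi (mulS S s t) = mulS S' (phi s) (phi t);
  ghom_zero : phi (zeroS S) = zeroS S';
  ghom_deg : forall s, elt S s -> phi s <> zeroS S' ->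
    deg S' (phi s) = deg S s
}.

Definition graded_iso (G : groupType) (T T' : Type) (S : gradedMagma G T)
    (S' : gradedMagma G T') (phi : T -> T') : Prop :=
  graded_hom S S' phi /\
  exists phi' : T' -> T, [/\ graded_hom S' S phi',
    forall s, elt S s -> phi' (phi s) = s
    & forall s', elt S' s' -> phi (phi' s') = s'].

Record graded_congruence (G : groupType) (T : Type) (S : gradedMagma G T)
    (sim : T -> T -> Prop) : Prop := {
  gcong_refl : forall s, elt S s -> sim s s;
  gcong_sym : forall s t, elt S s -> elt S t -> sim s t -> sim t s;
  gcong_trans : forall s t u, elt S s -> elt S t -> elt S u ->
    sim s t -> sim t u -> sim s u;
  gcong_mul : forall s t u v, elt S s -> elt S t -> elt S u -> elt S v ->
    sim s t -> sim u v -> sim (mulS S s u) (mulS S t v);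
  gcong_zero : forall s, elt S s -> sim s (zeroS S) -> s = zeroS S;
  gcong_deg : forall s t, elt S s -> elt S t -> s <> zeroS S -> sim s t ->
    deg S s = deg S t
}.

Definition class (G : groupType) (T : Type) (S : gradedMagma G T)
    (sim : T -> T -> Prop) (s : T) : set T :=
  [set t | elt S t /\ sim s t].

(* For a graded congruence [sim], the product of two classes is the class of
   the products of their elements, and the degree of a non-zero class is the
   common degree of its elements. *)
Definition quotient (G : groupType) (T : Type) (S : gradedMagma G T)
    (sim : T -> T -> Prop) : gradedMagma G (set T) :=
  {| elt := class S sim @` elt S;
     mulS := fun A B => [set u | elt S u /\
       exists s t, [/\ A s, B t & sim (mulS S s t) u]];
     zeroS := class S sim (zeroS S);
     deg := fun A => xget 1%g [set g | exists2 s, A s & deg S s = g] |}.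

(** * Groupoids *)

(* Objects and arrows are separate types, [gid] sending an object to its
   identity arrow.  The product [gmul a b] is only meaningful when
   [gdom a = gran b]. *)
Record topologicalGroupoid := TopologicalGroupoid {
  Obj : topologicalType;
  Arr : topologicalType;
  gdom : Arr -> Obj;
  gran : Arr -> Obj;
  gid : Obj -> Arr;
  ginv : Arr -> Arr;
  gmul : Arr -> Arr -> Arr;
  gdom_id : forall x, gdom (gid x) = x;
  gran_id : forall x, gran (gid x) = x;
  gdom_mul : forall a b, gdom a = gran b -> gdom (gmul a b) = gdom b;
  gran_mul : forall a b, gdom a = gran b -> gran (gmul a b) = gran a;
  gmulA : forall a b c, gdom a = gran b -> gdom b = gran c ->
    gmul a (gmul b c) = gmul (gmul a b) c;
  gmulid : forall a, gmul a (gid (gdom a)) = a;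
  gidmul : forall a, gmul (gid (gran a)) a = a;
  gdom_inv : forall a, gdom (ginv a) = gran a;
  gran_inv : forall a, gran (ginv a) = gdom a;
  gmulV : forall a, gmul a (ginv a) = gid (gran a);
  gVmul : forall a, gmul (ginv a) a = gid (gdom a);
  gdom_continuous : continuous gdom;
  gran_continuous : continuous gran;
  gid_continuous : continuous gid;
  ginv_continuous : continuous ginv;
  gmul_continuous :
    {within [set p : Arr * Arr | gdom p.1 = gran p.2],
      continuous (fun p : Arr * Arr => gmul p.1 p.2)}
}.

Record gradedGroupoid (G : groupType) := GradedGroupoid {
  groupoid_of :> topologicalGroupoid;
  cocycle : Arr groupoid_of -> G;
  cocycle_id : forall x, cocycle (gid x) = 1%g;
  cocycle_mul : forall a b : Arr groupoid_of, gdom a = gran b ->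
    cocycle (gmul a b) = (cocycle a * cocycle b)%g;
  cocycle_continuous :
    continuous (cocycle : Arr groupoid_of -> discrete_topology G)
}.

Definition local_homeomorphism (T T' : topologicalType) (f : T -> T') : Prop :=
  forall x, exists U : set T, [/\ open U, U x, open (f @` U),
    {within U, continuous f}
    & exists f' : T' -> T, (forall y, U y -> f' (f y) = y) /\
        {within f @` U, continuous f'}].

Definition boolean_space (T : topologicalType) : Prop :=
  hausdorff_space T /\
  exists B : set (set T), basis B /\ forall K, B K -> compact K.

Definition etale (X : topologicalGroupoid) : Prop :=
  local_homeomorphism (@gdom X).

Definition ample (X : topologicalGroupoid) : Prop :=
  etale X /\ boolean_space (Obj X).

Definition hausdorff_groupoid (X : topologicalGroupoid) : Prop :=
  hausdorff_space (Arr X).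

Definition local_bisection (X : topologicalGroupoid) (U : set (Arr X)) : Prop :=
  [/\ open U, set_inj U (@gdom X) & set_inj U (@gran X)].

Definition homogeneous_part (G : groupType) (X : gradedGroupoid G) (g : G) :
    set (Arr X) := @cocycle G X @^-1` [set g].
Arguments homogeneous_part {G} X g _.

Definition homogeneous (G : groupType) (X : gradedGroupoid G)
    (U : set (Arr X)) : Prop :=
  exists g, U `<=` homogeneous_part X g.

Definition bisections (G : groupType) (X : gradedGroupoid G) :
    gradedMagma G (set (Arr X)) :=
  {| elt := [set U | [/\ homogeneous U, compact U & local_bisection U]];
     mulS := fun U V => [set c | exists a b,
       [/\ U a, V b, gdom a = gran b & c = gmul a b]];
     zeroS := set0;
     deg := fun U => xget 1%g [set g | U `<=` homogeneous_part X g] |}.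

(** * The groupoid algebra and the normalizer of its diagonal *)

Definition supp (T : Type) (R : comPzRingType) (f : T -> R) : set T :=
  [set x | f x <> 0].

Definition galg (R : comPzRingType) (X : topologicalGroupoid) :
    set (Arr X -> R) :=
  [set f : Arr X -> R | (forall a, \forall b \near a, f b = f a) /\ compact (supp f)].
Arguments galg : clear implicits.

(* For [f] and [h] in [galg R X] with [X] étale the family has finite support,
   so that the sum is the genuine one. *)
Definition conv (R : comPzRingType) (X : topologicalGroupoid)
    (f h : Arr X -> R) : Arr X -> R :=
  fun c => \sum_(a \in [set a | gdom a = gdom c]) (f (gmul c (ginv a)) * h a).

Definition galg_part (G : groupType) (R : comPzRingType)
    (X : gradedGroupoid G) (g : G) : set (Arr X -> R) :=
  [set f : Arr X -> R | galg R X f /\ supp f `<=` homogeneous_part X g].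
Arguments galg_part {G} R X g _.

Definition diagonal (R : comPzRingType) (X : topologicalGroupoid) :
    set (Arr X -> R) :=
  [set f : Arr X -> R | galg R X f /\ supp f `<=` range (@gid X)].
Arguments diagonal : clear implicits.

Definition normalizing_pair (G : groupType) (R : comPzRingType)
    (X : gradedGroupoid G) (g : G) (m m' : Arr X -> R) : Prop :=
  [/\ galg_part R X g m, galg_part R X g^-1%g m',
      conv (conv m m') m = m, conv (conv m' m) m' = m'
    & forall f, diagonal R X f ->
        diagonal R X (conv (conv m f) m') /\
        diagonal R X (conv (conv m' f) m)].

Definition normalizer_part (G : groupType) (R : comPzRingType)
    (X : gradedGroupoid G) (g : G) : set (Arr X -> R) :=
  [set m | exists m', normalizing_pair g m m'].
Arguments normalizer_part {G} R X g _.

Definition normalizer (G : groupType) (R : comPzRingType)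
    (X : gradedGroupoid G) : gradedMagma G (Arr X -> R) :=
  {| elt := \bigcup_g normalizer_part R X g;
     mulS := @conv R X;
     zeroS := fun=> 0;
     deg := fun m => xget 1%g [set g | normalizer_part R X g m] |}.

Definition normalizer_sim (G : groupType) (R : comPzRingType)
    (X : gradedGroupoid G) (m n : Arr X -> R) : Prop :=
  exists m' n', [/\ exists g, normalizing_pair g m m',
    exists h, normalizing_pair h n n',
    conv m' m = conv n' n & diagonal R X (conv m n')].

Definition local_bisection_hypothesis (G : groupType) (R : comPzRingType)
    (X : gradedGroupoid G) : Prop :=
  forall m, elt (normalizer R X) m -> local_bisection (supp m).

Definition psi (G : groupType) (R : comPzRingType) (X : gradedGroupoid G)
    (U : set (Arr X)) : set (Arr X -> R) :=
  class (normalizer R X) (@normalizer_sim G R X) (\1_U : Arr X -> R).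

(* Main.v *)
(* Functions in the algebra are sums of multiples of indicator functions of
   compact open bisections, so that the convolution product inherits its
   properties from the set product.  Multiplying by a diagonal element is
   pointwise multiplication; as [m ~ n] implies [m = (m n') n] with [m n']
   diagonal, equivalent normalizers have the same support, which makes [psi]
   injective and identifies its image with the normalizers whose support is a
   local bisection.  Conversely, if [U = supp m] is a local bisection then
   [m' m] is an idempotent function on units, and indecomposability of [R]
   forces it to be the indicator function of [d(U)], whence [m ~ chi_U]. *)
Require Import Defs.
From HB Require Import structures.
From mathcomp Require Import all_boot all_order all_algebra.
From mathcomp Require Import all_classical all_reals all_analysis.

Set Implicit Arguments.
Unset Strict Implicit.
Unset Printing Implicit Defensive.

Import GRing.Theory.

Local Open Scope classical_set_scope.
Local Open Scope ring_scope.

(* Unlike [compact_cover], this does not need a pointed space. *)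
Lemma compact_induction (T : topologicalType) (K : set T) (Q : set T -> Prop) :
  compact K -> Q set0 -> (forall A B, A `<=` B -> Q B -> Q A) ->
  (forall A B, Q A -> Q B -> Q (A `|` B)) ->
  (forall x, K x -> exists2 V, nbhs x V & Q V) -> Q K.
Proof.
move=> Kco Q0 Qsub QU Qloc; apply: contrapT => NQ.
(* If [Q K] failed, the sets whose complement in [K] satisfies [Q] would form a proper filter
   containing [K]; a cluster point in [K] then contradicts the local hypothesis. *)
pose F : set_system T := [set A | Q (K `\` A)].
have FF : ProperFilter F.
  apply: Build_ProperFilter_ex => [A|].
    apply: contraPP => /forallNP A0 FA; apply: NQ; apply: Qsub FA => x Kx.
    by split=> // /A0.
  split.
  - by apply: Qsub Q0 => x [_]; apply.
  - move=> A B FA FB; apply: Qsub (QU _ _ FA FB) => x [Kx].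
    by move=> /not_andP[]; [left|right].
  - by move=> A B AB; apply: Qsub => x [Kx NB]; split=> // /AB.
have [|p [Kp Fp]] := Kco F FF; first by apply: Qsub Q0 => x [].
have [V Vp QV] := Qloc p Kp.
have FV : F (~` V) by apply: Qsub QV => x [_ /contrapT].
by have [x [NVx]] := Fp _ _ FV Vp.
Qed.

(** * Products of bisections *)

Section Groupoid.
Variable X : topologicalGroupoid.
Implicit Types (a b c : Arr X) (x : Obj X) (U V W : set (Arr X)).

Lemma gmulK a b : gdom a = gran b -> gmul (gmul a b) (ginv b) = a.
Proof.
by move=> ab; rewrite -gmulA ?gran_inv// gmulV -ab gmulid.
Qed.

Lemma gmulVK a b : gdom a = gdom b -> gmul (gmul a (ginv b)) b = a.
Proof.
by move=> ab; rewrite -gmulA ?gran_inv ?gdom_inv// gVmul -ab gmulid.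
Qed.

Lemma gdom_mulV a b : gdom a = gdom b -> gdom (gmul a (ginv b)) = gran b.
Proof. by move=> ab; rewrite gdom_mul ?gran_inv ?gdom_inv. Qed.

(** Multiplying back by [b] recovers [a], and an identity times [b] is [b]. This leaves a single
    term in a convolution with a diagonal factor on the left. *)
Lemma gmulV_id a b : gdom a = gdom b -> range (@gid X) (gmul a (ginv b)) ->
  a = b.
Proof.
move=> ab [x _ e]; have := gmulVK ab; rewrite -e.
have <- : gran b = x by rewrite -(gdom_mulV ab) -e gdom_id.
by rewrite gidmul.
Qed.

Lemma ginvK : involutive (@ginv X).
Proof.
move=> a; have e : gran a = gran (ginv (ginv a)) by rewrite gran_inv gdom_inv.
rewrite -[LHS]gidmul -e -gmulV -gmulA ?gran_inv ?gdom_inv//.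
by rewrite gmulV gran_inv gmulid.
Qed.

Lemma ginv_mul a b : gdom a = gran b ->
  ginv (gmul a b) = gmul (ginv b) (ginv a).
Proof.
move=> ab; have h : gdom (ginv (gmul a b)) = gran a by rewrite gdom_inv gran_mul.
have h1 : gmul (ginv (gmul a b)) a = ginv b.
  rewrite -[X in gmul _ X](gmulK ab) gmulA ?gran_inv ?gdom_mul ?gdom_inv//.
  by rewrite gVmul gdom_mul// -(gran_inv b) gidmul.
by rewrite -h1 gmulK.
Qed.

Lemma ginv_id x : ginv (gid x) = gid x.
Proof.
have e : gran (ginv (gid x)) = x by rewrite gran_inv gdom_id.
by have := gidmul (ginv (gid x)); rewrite e gmulV gran_id.
Qed.

Lemma gid_mul x : gmul (gid x) (gid x) = gid x :> Arr X.
Proof. by rewrite -{3}[gid x]gmulid gdom_id. Qed.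

Lemma gmul_idem a : gdom a = gran a -> gmul a a = a -> a = gid (gdom a).
Proof. by move=> ar e; rewrite ar -gmulV -{2}e gmulK. Qed.

(** The product of [bisections], isolated so that it makes sense without a grading. *)
Definition set_gmul U V : set (Arr X) :=
  [set c | exists a b, [/\ U a, V b, gdom a = gran b & c = gmul a b]].

Lemma set_gmulA U V W :
  set_gmul U (set_gmul V W) = set_gmul (set_gmul U V) W.
Proof.
apply/seteqP; split=> c.
  move=> [a [_ [Ua [b [d [Vb Wd bd ->]]] e ->]]].
  rewrite gran_mul// in e; rewrite gmulA//.
  by exists (gmul a b), d; split=> //; [exists a, b|rewrite gdom_mul].
move=> [_ [d [[a [b [Ua Vb ab ->]]] Wd e ->]]].
rewrite gdom_mul// in e; rewrite -gmulA//.
by exists a, (gmul b d); split=> //; [exists b, d|rewrite gran_mul].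
Qed.

Lemma set_gmul_id U V : U `<=` range (@gid X) -> V `<=` range (@gid X) ->
  set_gmul U V = U `&` V.
Proof.
move=> Ui Vi; apply/seteqP; split=> c.
  move=> [a [b [Ua Vb + ->]]]; have [x _ ax] := Ui _ Ua; have [y _ bx] := Vi _ Vb.
  by rewrite -{1}ax -{1}bx gdom_id gran_id => xy; subst x a b; rewrite gid_mul.
move=> [Uc Vc]; have [x _ cx] := Ui _ Uc; exists c, c; split=> //.
  by rewrite -cx gdom_id gran_id.
by rewrite -cx gid_mul.
Qed.

(** Write [a] in [U] as [gmul b c] with [b], [c] in [U]: comparing domains gives [c = a], comparing
    ranges gives [b = a], so [a] is idempotent. *)
Lemma set_gmul_idem U : local_bisection U -> set_gmul U U = U ->
  U `<=` range (@gid X).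
Proof.
move=> [_ dU rU] UU a Ua; have := Ua; rewrite -{1}UU => -[b [c [Ub Uc bc e]]].
have ac : a = c by apply: dU; rewrite ?inE// e gdom_mul.
have ab : a = b by apply: rU; rewrite ?inE// e gran_mul.
subst b c; exists (gdom a) => //; apply/esym/gmul_idem => //.
Qed.

(** In a triple product of [a], [b], [d] with [a], [ginv b] and [d] in [U], the arrows [a] and
    [ginv b] share their domain, hence coincide, and the product collapses to [d]. *)
Lemma set_gmulV U : set_inj U (@gdom X) ->
  set_gmul (set_gmul U (@ginv X @^-1` U)) U = U.
Proof.
move=> dU; apply/seteqP; split=> c.
  move=> [_ [d [[a [b [Ua Ub ab ->]]] Ud e ->]]].
  have {ab} ab : a = ginv b by apply: dU; rewrite ?inE// gdom_inv.
  subst a; rewrite gdom_mul ?gdom_inv// in e.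
  by rewrite gVmul e gidmul.
move=> Uc; exists (gmul c (ginv c)), c; split=> //.
- exists c, (ginv c); split=> //=; first by rewrite ginvK.
  by rewrite gran_inv.
- by rewrite gdom_mulV.
- by rewrite gmulVK.
Qed.

Lemma set_ginvK U : @ginv X @^-1` (@ginv X @^-1` U) = U.
Proof. by apply/seteqP; split=> a /=; rewrite ginvK. Qed.

Lemma set_gmul_bisection_inj U V :
  set_inj U (@gdom X) -> set_inj V (@gdom X) ->
  set_inj (set_gmul U V) (@gdom X).
Proof.
move=> dU dV _ _ /set_mem[a [b [Ua Vb ab ->]]] /set_mem[c [d [Uc Vd cd ->]]].
rewrite !gdom_mul// => bd.
have {}bd : b = d by apply: dV; rewrite ?inE.
subst d; congr gmul; apply: dU; rewrite ?inE//; congruence.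
Qed.

Lemma set_ginv_mul U V :
  @ginv X @^-1` (set_gmul U V) = set_gmul (@ginv X @^-1` V) (@ginv X @^-1` U).
Proof.
apply/seteqP; split=> c /= [a [b [Ha Hb ab e]]].
  exists (ginv b), (ginv a); rewrite /= !ginvK; split=> //.
    by rewrite gdom_inv gran_inv.
  by rewrite -ginv_mul// -e ginvK.
exists (ginv b), (ginv a); split => //; first by rewrite gdom_inv gran_inv.
by rewrite e ginv_mul.
Qed.

Lemma local_bisectionV U : local_bisection U ->
  local_bisection (@ginv X @^-1` U).
Proof.
move=> [oU dU rU]; split.
- by apply: open_comp => // a _; apply: ginv_continuous.
- move=> a b /set_mem Ua /set_mem Ub e; apply: (can_inj ginvK).
  by apply: rU; rewrite ?inE// !gran_inv.
- move=> a b /set_mem Ua /set_mem Ub e; apply: (can_inj ginvK).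
  by apply: dU; rewrite ?inE// !gdom_inv.
Qed.

(** The preimage form serves openness, the image form compactness. *)
Lemma set_ginv_image U : @ginv X @^-1` U = @ginv X @` U.
Proof.
apply/seteqP; split=> [a Ua|_ [a Ua <-]] /=; last by rewrite ginvK.
by exists (ginv a) => //; rewrite ginvK.
Qed.

Lemma compactV U : compact U -> compact (@ginv X @^-1` U).
Proof.
move=> Uco; rewrite set_ginv_image; apply: continuous_compact => //.
by apply: continuous_subspaceT; apply: ginv_continuous.
Qed.

(** * Topology of étale groupoids: compact open bisections and their products *)

Hypotheses (Xetale : etale X) (Xbool : boolean_space (Obj X))
  (Xhaus : hausdorff_groupoid X).

(** A local inverse [f] of [gdom] near [a] carries a small compact open set [K] of objects to the
    required bisection: compact as a continuous image, open as the part of [S] lying over [K]. *)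
Lemma compact_bisection_basis a W : nbhs a W ->
  exists B, [/\ local_bisection B, compact B, B a & B `<=` W].
Proof.
move=> aW; have [U [oU Ua oV _ [f [fK fcont]]]] := Xetale a.
have [U2 [oU2 U2a _ _ [f2 [f2K _]]]] := Xetale (ginv a).
(* Injectivity of [gdom] on [U2], around [ginv a], becomes injectivity of [gran] on [S]. *)
pose S := U `&` (@ginv X @^-1` U2) `&` interior W.
have oS : open S.
  apply: openI; last exact: open_interior.
  by apply: openI => //; apply: open_comp => // b _; apply: ginv_continuous.
rewrite continuous_open_subspace// in fcont.
have odS : open (@gdom X @` S).
  have -> : @gdom X @` S = (@gdom X @` U) `&` f @^-1` S.
    apply/seteqP; split=> [_ [b Sb <-]|_ [[b Ub <-]]] /=.
      by have [[Ub _] _] := Sb; rewrite /= fK//; split=> //; exists b.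
    by rewrite fK// => Sb; exists b.
  by move/continuous_inP : fcont; apply.
have Sa : S a by split=> //; apply: nbhs_singleton; apply: nbhs_interior.
have [_ [Bs [[Bopen Bbas] Bco]]] := Xbool.
have [K [BK Ka] KS] : exists2 K, Bs K /\ K (gdom a) & K `<=` @gdom X @` S.
  by apply: Bbas; apply: open_nbhs_nbhs; split=> //; exists a.
have fS y : K y -> S (f y) /\ gdom (f y) = y.
  by move=> /KS[b Sb <-]; have [[Ub _] _] := Sb; rewrite fK.
exists (f @` K); split.
- split.
  + have -> : f @` K = S `&` @gdom X @^-1` K.
      apply/seteqP; split=> [_ [y Ky <-]|b [Sb Kb]] /=.
        by have [? ->] := fS _ Ky.
      by exists (gdom b) => //; have [[Ub _] _] := Sb; rewrite fK.
    apply: openI => //; apply: open_comp; last exact: Bopen.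
    by move=> b _; apply: gdom_continuous.
  + by move=> _ _ /set_mem[y /fS[_ yE] <-] /set_mem[z /fS[_ zE] <-];
      rewrite yE zE => ->.
  + move=> _ _ /set_mem[y /fS[Sy yE] <-] /set_mem[z /fS[Sz zE] <-] e.
    have [[_ U2y] _] := Sy; have [[_ U2z] _] := Sz.
    by apply: (can_inj ginvK); rewrite -(f2K _ U2y) -(f2K _ U2z) !gdom_inv e.
- apply: continuous_compact; last exact: Bco.
  apply: continuous_in_subspaceT => y /set_mem Ky.
  by apply: fcont; rewrite inE; have [b [[]]] := KS _ Ky; exists b.
- by exists (gdom a) => //; rewrite fK.
- by move=> _ [y /fS[[_ /interior_subset Wy] _] <-].
Qed.

(** Étaleness in a form suited to filters: [s] is a total function, but it is controlled only near
    [gdom b]. *)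
Lemma local_section b : exists s : Obj X -> Arr X,
  [/\ s (gdom b) = b, \forall x \near gdom b, gdom (s x) = x
    & s @ gdom b --> b].
Proof.
have [U [oU Ub oV _ [s [sK scont]]]] := Xetale b.
rewrite continuous_open_subspace// in scont.
exists s; split; first exact: sK.
  apply: filterS (open_nbhs_nbhs (conj oV _)); last by exists b.
  by move=> _ [c Uc <-]; rewrite sK.
rewrite -{2}(sK _ Ub); apply: scont; rewrite inE; by exists b.
Qed.

Lemma open_gdom U : open U -> open (@gdom X @` U).
Proof.
move=> oU; rewrite openE => _ [b Ub <-].
have [s [sb sE sc]] := local_section b.
have sU : \forall x \near gdom b, U (s x).
  by apply: sc; apply: open_nbhs_nbhs.
by apply: filterS2 sE sU => x xE Ux; exists (s x).
Qed.

Lemma open_gran U : open U -> open (@gran X @` U).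
Proof.
move=> oU; have -> : @gran X @` U = @gdom X @` (@ginv X @^-1` U).
  apply/seteqP; split=> [_ [b Ub <-]|_ [b Ub <-]].
    by exists (ginv b); rewrite /= ?ginvK ?gdom_inv.
  by exists (ginv b); rewrite ?gran_inv.
by apply: open_gdom; apply: open_comp => // b _; apply: ginv_continuous.
Qed.

(** An arrow [a] close to a unit lies, together with [gid (gdom a)], in an open set on which [gdom]
    is injective; having the same domain, the two agree. *)
Lemma open_gid (K : set (Obj X)) : open K -> open (@gid X @` K).
Proof.
move=> oK; rewrite openE => _ [x Kx <-].
have [U [oU Ux _ _ [f [fK _]]]] := Xetale (gid x).
have : nbhs (gid x) (U `&` @gdom X @^-1` (K `&` @gid X @^-1` U)).
  apply: open_nbhs_nbhs; split; last by split=> //=; rewrite gdom_id.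
  apply: openI => //; apply: open_comp => [b _|]; first exact: gdom_continuous.
  apply: openI => //; apply: open_comp => // y _; exact: gid_continuous.
apply: filterS => a [Ua [/= Ka Uia]]; exists (gdom a) => //.
by rewrite -[RHS](fK _ Ua) -[LHS](fK _ Uia) gdom_id.
Qed.

(** With [s] a local section through [b], every [c'] near [c] factors as [c'] times the inverse of
    [s (gdom c')], times [s (gdom c')]; by continuity the two factors stay in [U] and [V]. *)
Lemma open_set_gmul U V : open U -> open V -> open (set_gmul U V).
Proof.
move=> oU oV; rewrite openE => c [a [b [Ua Vb ab cE]]].
have dcb : gdom c = gdom b by rewrite cE gdom_mul.
have [s [sb sE sc]] := local_section b.
rewrite -dcb in sb sE sc.
have gs : (fun c' => s (gdom c')) @ c --> b.
  by apply: cvg_comp sc; apply: gdom_continuous.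
have nV : \forall c' \near c, V (s (gdom c')).
  by apply: gs; apply: open_nbhs_nbhs.
(* Multiplication is continuous only within the composable pairs, so membership in [U] is
   conditional on composability. *)
have nU : \forall c' \near c, gdom c' = gran (ginv (s (gdom c'))) ->
    U (gmul c' (ginv (s (gdom c')))).
  have hc : (fun c' => (c', ginv (s (gdom c')))) @ c --> (c, ginv b).
    apply: cvg_pair => //=.
    by apply: (cvg_comp _ _ gs); apply: ginv_continuous.
  have /subspace_continuousP/(_ (c, ginv b)) := @gmul_continuous X.
  rewrite /= gran_inv => /(_ dcb) mc.
  have : nbhs (gmul c (ginv b)) U.
    by rewrite cE gmulK//; apply: open_nbhs_nbhs.
  by move=> /mc; exact: hc.
have nE : \forall c' \near c, gdom (s (gdom c')) = gdom c'.
  exact: gdom_continuous sE.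
near=> c'; exists (gmul c' (ginv (s (gdom c')))), (s (gdom c')).
have e : gdom (s (gdom c')) = gdom c' by near: c'.
split.
- have : gdom c' = gran (ginv (s (gdom c'))) by rewrite gran_inv.
  by near: c'.
- by near: c'.
- by rewrite gdom_mulV.
- by rewrite gmulVK.
Unshelve. all: by end_near. Qed.

(** The composable pairs form a closed set because the object space is Hausdorff; the product is the
    continuous image of its compact intersection with the rectangle. *)
Lemma compact_set_gmul U V : compact U -> compact V -> compact (set_gmul U V).
Proof.
move=> Uco Vco.
pose D := [set p : Arr X * Arr X | gdom p.1 = gran p.2].
have cD : closed D.
  move=> [a b] ab; apply: Xbool.1 => A B nA nB.
  have [|[a' b'] /= [e [Aa Bb]]] :=
      ab ((@gdom X @^-1` A) `*` (@gran X @^-1` B)).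
    exists (@gdom X @^-1` A, @gran X @^-1` B) => //; split=> /=.
      exact: gdom_continuous.
    exact: gran_continuous.
  by exists (gdom a'); split=> //; rewrite [gdom a']e.
have -> : set_gmul U V = (fun p => gmul p.1 p.2) @` ((U `*` V) `&` D).
  apply/seteqP; split=> [_ [a [b [Ua Vb ab ->]]]|_ [[a b] [[/= Ua Vb] ab] <-]].
    by exists (a, b).
  by exists a, b.
apply: continuous_compact.
  by apply: continuous_subspaceW (@gmul_continuous X) => p [].
by apply: compact_closedI => //; apply: compact_setX.
Qed.

Lemma set_gmul_bisection U V : local_bisection U -> local_bisection V ->
  local_bisection (set_gmul U V).
Proof.
move=> bU bV; have [oU dU rU] := bU; have [oV dV rV] := bV; split.
- exact: open_set_gmul.
- exact: set_gmul_bisection_inj.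
(* Injectivity of [gran] is injectivity of [gdom] on the inverse set, which is the product of the
   inverses in reverse order. *)
- have [_ dU' _] := local_bisectionV bU; have [_ dV' _] := local_bisectionV bV.
  have := set_gmul_bisection_inj dV' dU'; rewrite -set_ginv_mul => h.
  move=> a b /set_mem Ha /set_mem Hb e; apply: (can_inj ginvK).
  by apply: h; rewrite ?inE /= ?ginvK// !gdom_inv.
Qed.

End Groupoid.

(** * The groupoid algebra *)

Section LocallyConstant.
Variables (T : topologicalType) (R : comPzRingType).
Implicit Types f h : T -> R.

Definition locally_constant f := forall a, \forall b \near a, f b = f a.

Lemma locally_constantD f h :
  locally_constant f -> locally_constant h -> locally_constant (f \+ h).
Proof. by move=> Hf Hh a; apply: filterS2 (Hf a) (Hh a) => b /= -> ->. Qed.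

Lemma locally_constantM f h : locally_constant f -> locally_constant h ->
  locally_constant (fun a => f a * h a).
Proof. by move=> Hf Hh a; apply: filterS2 (Hf a) (Hh a) => b /= -> ->. Qed.

Lemma locally_constant_indic (C : set T) :
  open C -> closed C -> locally_constant (\1_C : T -> R).
Proof.
move=> oC cC a; have [Ca|NCa] := pselect (C a).
  apply: filterS (open_nbhs_nbhs (conj oC Ca)) => b Cb.
  by rewrite !indicE !mem_set.
apply: filterS (open_nbhs_nbhs (conj (closed_openC cC) NCa)) => b NCb.
by rewrite !indicE !memNset.
Qed.

Lemma open_supp f : locally_constant f -> open (supp f).
Proof.
move=> Hf; rewrite openE => a fa; apply: filterS (Hf a) => b.
by rewrite /supp /= => ->.
Qed.

Lemma closed_supp f : locally_constant f -> closed (supp f).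
Proof.
move=> Hf; rewrite -[supp f]setCK; apply: open_closedC; rewrite openE => a fa.
by apply: filterS (Hf a) => b; rewrite /supp /= => ->.
Qed.

End LocallyConstant.

Section Algebra.
Variables (R : comPzRingType) (X : topologicalGroupoid).
Implicit Types (f h k : Arr X -> R) (U V : set (Arr X)) (C : set (Arr X)).

Local Notation "f ** h" := (Defs.conv f h) (at level 40, left associativity).
Local Notation galg := (galg R X).
Local Notation D := (Defs.diagonal R X).

Lemma galg_sub f C :
  locally_constant f -> compact C -> supp f `<=` C -> galg f.
Proof.
by move=> Hf Cco fC; split=> //; apply: subclosed_compact fC => //;
  apply: closed_supp.
Qed.

Lemma suppD f h : supp (f \+ h) `<=` supp f `|` supp h.
Proof.
move=> a; apply: contra_notP => /not_orP[/contrapT fa /contrapT ha].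
by rewrite /= fa ha addr0.
Qed.

Lemma galgD f h : galg f -> galg h -> galg (f \+ h).
Proof.
move=> [lf cf] [lh ch]; apply: (galg_sub (C := supp f `|` supp h)).
- exact: locally_constantD.
- exact: compactU.
- exact: suppD.
Qed.

Lemma galgMindic f C : galg f -> open C -> closed C ->
  galg (fun a => f a * \1_C a).
Proof.
move=> [lf cf] oC cC; apply: (galg_sub (C := supp f)) => //.
  by apply: locally_constantM => //; apply: locally_constant_indic.
by move=> a; apply: contra_not => fa; rewrite fa mul0r.
Qed.

Lemma supp_indic_sub C : supp (\1_C : Arr X -> R) `<=` C.
Proof. by move=> a; apply: contra_notP => Ca; rewrite indicE memNset. Qed.

Lemma conv_supp f h : supp (f ** h) `<=` set_gmul (supp f) (supp h).
Proof.
move=> c; apply: contra_notP => N; apply: fsbig1 => a /= ac.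
apply: contrapT => fha; apply: N; exists (gmul c (ginv a)), a; split.
- by move=> f0; apply: fha; rewrite f0 mul0r.
- by move=> h0; apply: fha; rewrite h0 mulr0.
- by rewrite gdom_mulV.
- by rewrite gmulVK.
Qed.

Lemma conv_single f h b c : gdom b = gdom c ->
  (forall a, gdom a = gdom c -> a <> b -> f (gmul c (ginv a)) * h a = 0) ->
  (f ** h) c = f (gmul c (ginv b)) * h b.
Proof.
move=> bc fh0; rewrite /Defs.conv -(fsbig_widen [set b]) ?fsbig_set1//.
  by move=> _ ->.
by move=> a [/= ac /eqP/eqP ab]; apply: fh0.
Qed.

(** A nonzero term needs [gmul c (ginv a)] to be an identity, which forces [a = c]. *)
Lemma conv_diagl f h c : supp f `<=` range (@gid X) ->
  (f ** h) c = f (gid (gran c)) * h c.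
Proof.
move=> fi; rewrite (@conv_single _ _ c)// ?gmulV// => a ac ca.
have [f0|fN0] := pselect (f (gmul c (ginv a)) = 0); first by rewrite f0 mul0r.
by case: ca; apply/esym/gmulV_id => //; exact: fi.
Qed.

Lemma conv_diagr f h c : supp h `<=` range (@gid X) ->
  (f ** h) c = f c * h (gid (gdom c)).
Proof.
move=> hi; rewrite (@conv_single _ _ (gid (gdom c))) ?gdom_id//.
  by rewrite ginv_id gmulid.
move=> a ac ca.
have [h0|hN0] := pselect (h a = 0); first by rewrite h0 mulr0.
by have [x _ xa] := hi _ hN0; case: ca; rewrite -ac -xa gdom_id.
Qed.

(** At most one arrow of [V] has the domain of [c], so at most one term is nonzero. The coefficients
    are carried along to match the generators of [galg_ind]. *)
Lemma conv_indic (r t : R) U V : set_inj V (@gdom X) ->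
  (fun a => r * \1_U a) ** (fun a => t * \1_V a) =
  (fun a => r * t * \1_(set_gmul U V) a).
Proof.
move=> dV; apply/funext => c; have [UVc|NUVc] := pselect (set_gmul U V c).
  rewrite indicE mem_set//; have [a [b [Ua Vb ab ->]]] := UVc.
  rewrite (@conv_single _ _ b) ?gdom_mul//.
    by rewrite gmulK// !indicE !mem_set// !mulr1.
  move=> d db; have [Vd bd|NVd _] := pselect (V d).
    by case: bd; apply: dV; rewrite ?inE.
  by rewrite [X in _ * (_ * X)]indicE memNset// !mulr0.
rewrite indicE memNset// mulr0; apply: contrapT.
move=> /conv_supp[a [b [fa hb ab cE]]].
apply: NUVc; exists a, b; split=> //; apply: contrapT => N.
  by apply: fa; rewrite indicE memNset// mulr0.
by apply: hb; rewrite indicE memNset// mulr0.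
Qed.

Lemma conv_indic1 U V : set_inj V (@gdom X) ->
  (\1_U : Arr X -> R) ** \1_V = \1_(set_gmul U V).
Proof.
have one W : (\1_W : Arr X -> R) = (fun a => 1 * \1_W a).
  by apply/funext => a; rewrite mul1r.
by move=> dV; rewrite (one U) (one V) (one (set_gmul U V)) conv_indic// mulr1.
Qed.

Lemma conv0r f : f ** (fun=> 0) = (fun=> 0).
Proof. by apply/funext => c; apply: fsbig1 => a _; rewrite mulr0. Qed.

Lemma conv0l f : (fun=> 0) ** f = (fun=> 0).
Proof. by apply/funext => c; apply: fsbig1 => a _; rewrite mul0r. Qed.

(** * Decomposition into indicators and the ring laws of convolution *)

Hypotheses (Xetale : etale X) (Xbool : boolean_space (Obj X))
  (Xhaus : hausdorff_groupoid X).

(** In a Hausdorff arrow space the compact open [U] is also closed, so its indicator is locally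
    constant. *)
Lemma galg_indic (r : R) U : open U -> compact U -> galg (fun a => r * \1_U a).
Proof.
move=> oU Uco; have cU := compact_closed Xhaus Uco.
apply: (galg_sub (C := U)) => //.
  apply: (locally_constantM (f := fun=> r)).
    by move=> a; apply: nearW.
  exact: locally_constant_indic.
by move=> a; apply: contra_notP => Ua; rewrite indicE memNset// mulr0.
Qed.

Lemma galg_indic1 U : open U -> compact U -> galg (\1_U).
Proof.
move=> oU Uco; rewrite (_ : \1_U = fun a => 1 * \1_U a); first exact: galg_indic.
by apply/funext => a; rewrite mul1r.
Qed.

(** Reduces additive statements to scaled indicators of compact bisections. Around each point of its
    support [f] is constant on such a bisection, and [compact_induction] assembles the pieces. *)
Lemma galg_ind (P : (Arr X -> R) -> Prop) :
  (forall r U, local_bisection U -> compact U -> P (fun a => r * \1_U a)) ->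
  (forall f h, galg f -> galg h -> P f -> P h -> P (f \+ h)) ->
  forall f, galg f -> P f.
Proof.
move=> Pind PD f gf; have [lf cf] := gf.
have P0 : P (fun=> 0).
  rewrite (_ : (fun=> 0) = (fun a => 0 * \1_set0 a)).
    apply: Pind; last exact: compact0.
    by split; [exact: open0|move=> ? ? /set_mem|move=> ? ? /set_mem].
  by apply/funext => a; rewrite mul0r.
(* A compact set on which [f] is constant peels off [f] one term [r * \1_U];
   quantifying over [C] makes the pieces disjoint. *)
pose Q (A : set (Arr X)) := exists B, [/\ open B, closed B, A `<=` B &
  forall C, open C -> closed C -> P (fun a => f a * \1_(B `&` C) a)].
have [B [oB cB fB PB]] : Q (supp f).
  apply: compact_induction => //.
  - exists set0; split=> //; first exact: open0; first exact: closed0.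
    move=> C _ _; rewrite (_ : (fun _ => _) = (fun=> 0))//.
    by apply/funext => a; rewrite set0I indicE memNset// mulr0.
  - by move=> A A' AA' [B [oB cB AB PB]]; exists B; split=> // a /AA'/AB.
  - move=> A A' [B [oB cB AB PB]] [B' [oB' cB' AB' PB']].
    exists (B `|` B'); split; [exact: openU|exact: closedU|exact: setUSS|].
    move=> C oC cC.
    have oCB : open (C `\` B).
      by rewrite setDE; apply: openI => //; apply: closed_openC.
    have cCB : closed (C `\` B).
      by rewrite setDE; apply: closedI => //; apply: open_closedC.
    have := PD _ _ _ _ (PB C oC cC) (PB' _ oCB cCB).
    rewrite (_ : _ \+ _ = (fun a => f a * \1_((B `|` B') `&` C) a)).
      by apply; apply: galgMindic => //; [apply: openI|apply: closedI|
        apply: openI|apply: closedI].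
    apply/funext => a; rewrite /= -mulrDr !indicE; congr (_ * _).
    rewrite !in_setI !in_setU in_setC.
    by case: (a \in B); case: (a \in B'); case: (a \in C);
      rewrite /= ?addr0 ?add0r.
  - move=> a fa.
    have [B [bB cB Ba Bf]] := compact_bisection_basis Xetale Xbool (lf a).
    have [oB dB rB] := bB.
    have clB := compact_closed Xhaus cB.
    exists B; first exact: open_nbhs_nbhs.
    exists B; split=> // C oC cC.
    rewrite (_ : (fun _ => _) = fun b => f a * \1_(B `&` C) b).
      apply: Pind; last exact: compact_closedI.
      split; first exact: openI.
        by move=> b c /set_mem[Bb _] /set_mem[Bc _]; apply: dB; rewrite inE.
      by move=> b c /set_mem[Bb _] /set_mem[Bc _]; apply: rB; rewrite inE.
    apply/funext => b; have [[Bb Cb]|N] := pselect ((B `&` C) b).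
      by rewrite (Bf b Bb).
    by rewrite indicE memNset// !mulr0.
have := PB _ openT closedT; congr P; apply/funext => a.
rewrite setIT indicE; have [Ba|NBa] := pselect (B a).
  by rewrite mem_set ?mulr1.
by rewrite memNset// mulr0; apply/esym; apply: contrapT => /fB.
Qed.

(** A bisection meets each fibre of [gdom] at most once, and finiteness passes to sums. This is what
    makes [conv] additive. *)
Lemma galg_fiber_finite f x : galg f ->
  finite_set ([set a | gdom a = x] `&` supp f).
Proof.
move: f; apply: galg_ind => [r U [_ dU _] _|f h _ _ Ff Fh].
  have [[a [ax Ua]]|N] := pselect (exists a, gdom a = x /\ U a).
    apply: (sub_finite_set (B := [set a])) => // b [/= bx].
    apply: contra_notP => ba; rewrite indicE memNset ?mulr0// => Ub; apply: ba.
    by apply: dU; rewrite ?inE// bx.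
  apply: (sub_finite_set (B := set0)) => // b [/= bx].
  apply: contra_notP => _; rewrite indicE memNset ?mulr0// => Ub.
  by apply: N; exists b.
apply: sub_finite_set (_ : finite_set (([set a | gdom a = x] `&` supp f) `|`
    ([set a | gdom a = x] `&` supp h))); last by rewrite finite_setU.
by rewrite -setIUr => a [/= ax /suppD].
Qed.

(** Moves the sum to an index set that can be taken finite, where sums split. *)
Lemma conv_finite f h c (S : set (Arr X)) :
  S `<=` [set a | gdom a = gdom c] ->
  [set a | gdom a = gdom c] `&` supp h `<=` S ->
  (f ** h) c = \sum_(a \in S) f (gmul c (ginv a)) * h a.
Proof.
move=> SF hS; apply/esym/fsbig_widen => // a [/= ac NSa].
apply: contrapT => fh0; apply/NSa/hS; split=> // h0.
by apply: fh0; rewrite h0 mulr0.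
Qed.

Lemma convDl f f' h : galg h -> (f \+ f') ** h = f ** h \+ f' ** h.
Proof.
move=> gh; apply/funext => c /=.
pose S := [set a | gdom a = gdom c] `&` supp h.
have fS : finite_set S by apply: galg_fiber_finite.
have SF : S `<=` [set a | gdom a = gdom c] by move=> a [].
rewrite !(@conv_finite _ h c S)//.
by rewrite -fsbig_split//; apply: eq_fsbigr => a _; rewrite /= mulrDl.
Qed.

Lemma convDr f h h' : galg h -> galg h' ->
  f ** (h \+ h') = f ** h \+ f ** h'.
Proof.
move=> gh gh'; apply/funext => c /=.
pose S := [set a | gdom a = gdom c] `&` (supp h `|` supp h').
have fS : finite_set S.
  by rewrite /S setIUr finite_setU; split; apply: galg_fiber_finite.
have hS : [set a | gdom a = gdom c] `&` supp h `<=` S.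
  by move=> a [? ?]; split=> //; left.
have hS' : [set a | gdom a = gdom c] `&` supp h' `<=` S.
  by move=> a [? ?]; split=> //; right.
have hhS : [set a | gdom a = gdom c] `&` supp (h \+ h') `<=` S.
  by move=> a [ax /suppD]; split.
have SF : S `<=` [set a | gdom a = gdom c] by move=> a [].
rewrite !(@conv_finite _ _ c S)// -fsbig_split//.
by apply: eq_fsbigr => a _; rewrite /= mulrDr.
Qed.

Lemma galg_conv f h : galg f -> galg h -> galg (f ** h).
Proof.
move=> + gh; move: f; apply: galg_ind => [r U bU cU|f f' _ _ gf gf']; last first.
  by rewrite convDl//; apply: galgD.
move: h gh; apply: galg_ind => [t V bV cV|h h' gh gh' gfh gfh']; last first.
  by rewrite convDr//; apply: galgD.
have [_ dV _] := bV; rewrite conv_indic//; apply: galg_indic.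
  by have [] := set_gmul_bisection Xetale bU bV.
exact: compact_set_gmul.
Qed.

(** Additivity in each argument leaves indicators, for which the claim is [set_gmulA] together with
    associativity in [R]. *)
Lemma conv_assoc f h k : galg f -> galg h -> galg k ->
  f ** (h ** k) = f ** h ** k.
Proof.
move=> gf gh gk; move: f gf.
apply: galg_ind => [r U bU cU|f f' gf gf' e e']; last first.
  by rewrite !convDl//; [rewrite e e'|exact: galg_conv].
have gU : galg (fun a => r * \1_U a) by case: bU => ? _ _; apply: galg_indic.
move: h gh; apply: galg_ind => [t V bV cV|h h' gh gh' e e']; last first.
  rewrite (convDr _ gh gh') !convDl// convDr; try exact: galg_conv.
  by rewrite e e'.
have gV : galg (fun a => t * \1_V a) by case: bV => ? _ _; apply: galg_indic.
move: k gk; apply: galg_ind => [u W bW cW|k k' gk gk' e e']; last first.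
  by rewrite !convDr ?e ?e'//; exact: galg_conv.
have [_ dV _] := bV; have [_ dW _] := bW.
rewrite !conv_indic ?set_gmulA ?mulrA//.
exact: set_gmul_bisection_inj.
Qed.

Lemma diagonal_conv f h : D f -> D h -> D (f ** h).
Proof.
move=> [gf fi] [gh hi]; split; first exact: galg_conv.
move=> c /conv_supp; rewrite /=.
by move=> [a [b [/fi[x _ <-] /hi[y _ <-]]]]; rewrite gdom_id gran_id => -> ->;
  rewrite gid_mul; exists y.
Qed.

(** Both products at [c] are [f c] times the value of [h] at the range or at the domain unit of [c];
    these units agree where [f c] is nonzero. *)
Lemma diagonal_convC f h : D f -> D h -> f ** h = h ** f.
Proof.
move=> [gf fi] [gh hi]; apply/funext => c.
rewrite (conv_diagr _ _ hi) (conv_diagl _ _ hi) mulrC.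
have [->|/fi[x _ <-]] := pselect (f c = 0); first by rewrite !mulr0.
by rewrite gdom_id gran_id.
Qed.

Lemma diagonal_indic U : open U -> compact U -> U `<=` range (@gid X) -> D \1_U.
Proof.
move=> oU Uco Ui; split; first exact: galg_indic1.
by move=> c /supp_indic_sub/Ui.
Qed.

(** The algebra need not have a unit, but the indicator of the units at the ranges of [supp f] is
    diagonal and fixes [f] from the left. *)
Lemma galg_local_unit f : galg f -> exists2 e, D e & e ** f = f.
Proof.
move=> [lf cf]; pose K := @gid X @` (@gran X @` supp f).
have De : D \1_K.
  apply: diagonal_indic.
  - by apply: open_gid => //; apply: open_gran => //; apply: open_supp.
  - apply: continuous_compact.
      by apply: continuous_subspaceT; apply: gid_continuous.
    apply: continuous_compact => //.
    by apply: continuous_subspaceT; apply: gran_continuous.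
  - by move=> _ [x _ <-]; exists x.
exists \1_K => //; apply/funext => c; rewrite conv_diagl; last by case: De.
have [->|fc] := pselect (f c = 0); first by rewrite mulr0.
by rewrite indicE mem_set ?mul1r//; exists (gran c) => //; exists c.
Qed.

End Algebra.

(** * Graded inverse semigroups and their quotients *)

Section GradedSemigroups.
Variables (G : groupType) (T : Type) (S : gradedMagma G T).

Local Notation "s * t" := (mulS S s t).

Definition commuting_idempotents := forall e f : T, elt S e -> elt S f ->
  e * e = e -> f * f = f -> e * f = f * e.

(** Commuting [s * t] with [s * u], and [t * s] with [u * s], shows that two inverses [t] and [u]
    both equal [t * s * u]. *)
Lemma unique_inverse :
  (forall s t, elt S s -> elt S t -> elt S (s * t)) ->
  (forall s t u, elt S s -> elt S t -> elt S u -> s * (t * u) = s * t * u) ->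
  commuting_idempotents ->
  forall s t, elt S s -> elt S t -> s * t * s = s -> t * s * t = t ->
  exists! t, [/\ elt S t, s * t * s = s & t * s * t = t].
Proof.
move=> SM SA SC s t Ss St sts tst; exists t; split=> // u [Su sus usu].
have [Sst Sts Ssu Sus] : [/\ elt S (s * t), elt S (t * s), elt S (s * u)
  & elt S (u * s)] by split; apply: (SM).
have e1 : s * t = s * t * (s * u).
  by rewrite (SC (s * t)) ?SA ?sts ?sus.
have e2 : u * s = t * s * (u * s).
  have -> : t * s * (u * s) = u * s * (t * s).
    by apply: SC => //; rewrite SA ?tst ?usu.
  by rewrite -SA// [s * (t * s)]SA// sts.
transitivity (t * s * u).
  by rewrite -{1}tst -SA// e1 SA// [t * _]SA// tst SA.
by rewrite -[RHS]usu e2 -[RHS]SA// usu.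
Qed.

End GradedSemigroups.

Section Quotient.
Variables (G : groupType) (T : Type) (S : gradedMagma G T).
Variable sim : T -> T -> Prop.
Hypotheses (Sgis : graded_inverse_semigroup S)
  (Ssim : graded_congruence S sim).
Local Notation "s * t" := (mulS S s t).
Local Notation Q := (quotient S sim).

Lemma class_eq s t : elt S s -> elt S t ->
  class S sim s = class S sim t <-> sim s t.
Proof.
move=> Ss St; split=> [st|st].
  have : class S sim t t by split=> //; exact: (gcong_refl Ssim).
  by rewrite -st => -[].
apply/seteqP; split=> u [Su su]; split=> //.
  exact: (gcong_trans Ssim St Ss Su (gcong_sym Ssim Ss St st) su).
exact: (gcong_trans Ssim Ss St Su st su).
Qed.

Lemma mul_class s t : elt S s -> elt S t ->
  mulS Q (class S sim s) (class S sim t) = class S sim (s * t).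
Proof.
move=> Ss St; apply/seteqP; split=> u /=.
  move=> [Su [s' [t' [[Ss' ss'] [St' tt'] stu]]]]; split=> //.
  apply: (gcong_trans Ssim _ _ Su _ stu); try exact: (gis_mul Sgis).
  exact: (gcong_mul Ssim).
move=> [Su stu]; split=> //; exists s, t; split=> //; split=> //;
  exact: (gcong_refl Ssim).
Qed.

Lemma class_neq0 s : elt S s -> class S sim s <> zeroS Q -> s <> zeroS S.
Proof. by move=> Ss + s0; rewrite s0. Qed.

Lemma deg_class s : elt S s -> s <> zeroS S -> deg Q (class S sim s) = deg S s.
Proof.
move=> Ss s0 /=; case: xgetP => [g _ [t [St st] <-]|/(_ (deg S s))].
  by rewrite (gcong_deg Ssim Ss St).
by case; exists s => //; split=> //; exact: (gcong_refl Ssim).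
Qed.

(* Lallement's lemma: if [a] is an idempotent class then so is that of the
   idempotent [a x a], with [x] inverse to [a a]. *)
Lemma lift_idempotent a : elt S a -> sim (a * a) a ->
  exists e, [/\ elt S e, e * e = e & sim e a].
Proof.
move=> Sa aaa; have SM := gis_mul Sgis; have SA := gis_assoc Sgis.
have Saa := SM _ _ Sa Sa.
have [x [[Sx axa xax] _]] := gis_inverse Sgis Saa.
have Sax := SM _ _ Sa Sx; have Saxa := SM _ _ Sax Sa.
exists (a * x * a); split=> //.
  have -> : a * x * a * (a * x * a) = a * (x * (a * a) * x) * a.
    by rewrite !SA; auto 7.
  by rewrite xax.
have aaa' := gcong_sym Ssim Saa Sa aaa.
apply: (gcong_trans Ssim Saxa Saa Sa _ aaa); rewrite -axa.
apply: (gcong_mul Ssim) => //; auto.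
apply: (gcong_mul Ssim) => //; exact: (gcong_refl Ssim).
Qed.

(** Inverses exist as classes of inverses. They are unique because idempotent classes lift to
    idempotents of [S], which commute. *)
Lemma quotient_graded_inverse_semigroup : commuting_idempotents S ->
  graded_inverse_semigroup Q.
Proof.
move=> SC; have SM := gis_mul Sgis; have S0 := gis_zero Sgis.
have QM A B : elt Q A -> elt Q B -> elt Q (mulS Q A B).
  move=> [s Ss <-] [t St <-]; rewrite mul_class//; exists (s * t) => //.
  exact: SM.
have QA A B C : elt Q A -> elt Q B -> elt Q C ->
    mulS Q A (mulS Q B C) = mulS Q (mulS Q A B) C.
  move=> [s Ss <-] [t St <-] [u Su <-].
  by rewrite !mul_class//; auto; rewrite (gis_assoc Sgis).
split=> //.
- by exists (zeroS S).
- move=> _ [s Ss <-]; rewrite [zeroS Q]/= mul_class//.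
  by rewrite (gis_mul0 Sgis).
- move=> _ [s Ss <-]; rewrite [zeroS Q]/= mul_class//.
  by rewrite (gis_0mul Sgis).
- move=> _ [s Ss <-]; have [t [[St sts tst] _]] := gis_inverse Sgis Ss.
  apply: (unique_inverse (S := Q) QM QA _ (t := class S sim t)).
  + move=> _ _ [a Sa <-] [b Sb <-]; rewrite !mul_class//.
    move=> /class_eq aa /class_eq bb.
    have [e [Se ee ea]] := lift_idempotent Sa (aa (SM _ _ Sa Sa) Sa).
    have [f [Sf ff fb]] := lift_idempotent Sb (bb (SM _ _ Sb Sb) Sb).
    rewrite -(mul_class Sa Sb) -(mul_class Sb Sa).
    rewrite -(class_eq Se Sa).2// -(class_eq Sf Sb).2//.
    by rewrite !mul_class// SC.
  + by exists s.
  + by exists t.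
  + by rewrite !mul_class ?sts; auto.
  + by rewrite !mul_class ?tst; auto.
- move=> _ _ [s Ss <-] [t St <-]; rewrite mul_class//; auto.
  move=> /class_neq0 st0; have {}st0 := st0 (SM _ _ Ss St).
  rewrite !deg_class//; auto; first exact: (gis_deg Sgis).
    by move=> t0; apply: st0; rewrite t0 (gis_mul0 Sgis).
  by move=> s0; apply: st0; rewrite s0 (gis_0mul Sgis).
Qed.

End Quotient.

Lemma bijective_graded_iso (G : groupType) (T T' : Type) (S : gradedMagma G T)
    (S' : gradedMagma G T') (phi : T -> T') :
  elt S (zeroS S) ->
  (forall s t, elt S s -> elt S t -> elt S (mulS S s t)) ->
  graded_hom S S' phi ->
  (forall s t, elt S s -> elt S t -> phi s = phi t -> s = t) ->
  elt S' `<=` phi @` elt S -> graded_iso S S' phi.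
Proof.
move=> S0 SM hphi phi_inj phi_surj; split=> //.
(* Off [elt S'] the requirement is vacuous, and [zeroS S] serves as a witness. *)
have /choice[phi' phi'P] s' :
    exists s, elt S' s' -> elt S s /\ phi s = s'.
  have [/phi_surj[s Ss ss']|?] := pselect (elt S' s'); last by exists (zeroS S).
  by exists s.
have phi'K s : elt S s -> phi' (phi s) = s.
  move=> Ss; have [S's phis] := phi'P _ (ghom_elt hphi Ss).
  exact: phi_inj.
exists phi'; split=> [|//|s' /phi'P[]//]; split.
- by move=> s' /phi'P[].
- move=> s' t' /phi'P[Ss es] /phi'P[St et].
  by rewrite -{1}es -{1}et -(ghom_mul hphi)// phi'K//; apply: SM.
- by rewrite -(ghom_zero hphi) phi'K.
- move=> s' /phi'P[Ss es] ns; rewrite -{2}es; apply/esym/(ghom_deg hphi) => //.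
  rewrite -(ghom_zero hphi); move=> /phi_inj e; exact/ns/e.
Qed.

(** * The inverse semigroup of homogeneous compact bisections *)

Section Bisections.
Variables (G : groupType) (X : gradedGroupoid G).
Implicit Types U V : set (Arr X).
Local Notation Gam := (bisections X).

Lemma homogeneous_set_gmul g h U V :
  U `<=` homogeneous_part X g -> V `<=` homogeneous_part X h ->
  set_gmul U V `<=` homogeneous_part X (g * h)%g.
Proof.
move=> Ug Vh _ [a [b [Ua Vb ab ->]]].
by rewrite /homogeneous_part /preimage /= cocycle_mul// (Ug _ Ua) (Vh _ Vb).
Qed.

Lemma cocycleV (a : Arr X) : cocycle (ginv a) = (cocycle a)^-1%g.
Proof.
have := cocycle_mul (esym (gran_inv a)); rewrite gmulV cocycle_id => e.
by apply/esym; rewrite -[RHS](mulKg (cocycle a)) -e mulg1.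
Qed.

Lemma homogeneousV g U : U `<=` homogeneous_part X g ->
  @ginv X @^-1` U `<=` homogeneous_part X g^-1%g.
Proof.
move=> Ug a /Ug; rewrite /homogeneous_part /preimage /= => <-.
by rewrite cocycleV invgK.
Qed.

(** Any point of [U] pins down the value picked by [xget]: its cocycle value is the only
    candidate. *)
Lemma deg_bisections g U : U <> set0 -> U `<=` homogeneous_part X g ->
  deg Gam U = g.
Proof.
move=> /eqP/set0P[a Ua] Ug /=; case: xgetP => [h _ Uh|/(_ g)]; last by case.
by rewrite -(Ug _ Ua) -(Uh _ Ua).
Qed.

Hypotheses (Xetale : etale X) (Xbool : boolean_space (Obj X)).

(** Idempotent bisections consist of units, and the product of two sets of units is their
    intersection, so idempotents commute. *)
Lemma bisections_graded_inverse_semigroup : graded_inverse_semigroup Gam.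
Proof.
have set0_gmul U : set_gmul set0 U = set0.
  by apply/seteqP; split=> c // [? [? []]].
have set_gmul0 U : set_gmul U set0 = set0.
  by apply/seteqP; split=> c // [? [? []]].
have mulE U V : mulS Gam U V = set_gmul U V by [].
have GM U V : elt Gam U -> elt Gam V -> elt Gam (mulS Gam U V).
  move=> [[g Ug] cU bU] [[h Vh] cV bV]; split.
  - by exists (g * h)%g; exact: homogeneous_set_gmul.
  - exact: compact_set_gmul.
  - exact: set_gmul_bisection.
split=> //.
- split; [by exists 1%g|exact: compact0|].
  by split; [exact: open0|move=> ? ? /set_mem|move=> ? ? /set_mem].
- by move=> U _; exact: set_gmul0.
- by move=> U _; exact: set0_gmul.
- by move=> U V W _ _ _; exact: set_gmulA.
- move=> U GU; have [[g Ug] cU bU] := GU; have [_ dU _] := bU.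
  have bV := local_bisectionV bU; have [_ dV _] := bV.
  apply: (@unique_inverse _ _ Gam GM _ _ U (@ginv X @^-1` U)) => //.
  + by move=> *; exact: set_gmulA.
  + move=> E F [_ _ bE] [_ _ bF] /(set_gmul_idem bE) Ei /(set_gmul_idem bF) Fi.
    by rewrite !mulE !set_gmul_id// setIC.
  + split; [|exact: compactV|exact: bV].
    by exists g^-1%g; apply: homogeneousV.
  + by rewrite !mulE set_gmulV.
  + by rewrite !mulE -{2}[U]set_ginvK set_gmulV.
- move=> U V [[g Ug] _ _] [[h Vh] _ _]; rewrite !mulE => UV0.
  rewrite (deg_bisections UV0 (homogeneous_set_gmul Ug Vh)).
  rewrite (deg_bisections _ Ug) ?(deg_bisections _ Vh)//.
    by move=> V0; apply: UV0; rewrite V0.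
  by move=> U0; apply: UV0; rewrite U0.
Qed.

End Bisections.

(** * The graded normalizer *)

Section Normalizer.
Variables (G : groupType) (R : comPzRingType) (X : gradedGroupoid G).
Implicit Types (g h : G) (m n f k : Arr X -> R).

Local Notation "f ** h" := (Defs.conv f h) (at level 40, left associativity).
Local Notation galg := (galg R X).
Local Notation D := (Defs.diagonal R X).
Local Notation N := (normalizer R X).
Local Notation sim := (@normalizer_sim G R X).

Lemma normalizing_pair_sym g m m' :
  normalizing_pair g m m' -> normalizing_pair g^-1%g m' m.
Proof.
move=> [gm gm' e e' H]; split=> //; first by rewrite invgK.
by move=> f Df; have [] := H f Df.
Qed.

Lemma normalizing_pair_elt g m m' : normalizing_pair g m m' ->
  elt N m /\ elt N m'.
Proof.
move=> p; split; first by exists g => //; exists m'.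
by exists g^-1%g => //; exists m; exact: normalizing_pair_sym.
Qed.

Lemma deg_normalizer g m : m <> (fun=> 0) -> normalizer_part R X g m ->
  deg N m = g.
Proof.
move=> m0 Nm /=; have [a ma] : exists a, m a <> 0.
  by apply: contra_notP m0 => /forallNP m0; apply/funext => a; exact: contrapT.
case: xgetP => [h _ [n [[_ mh] _ _ _ _]]|/(_ g)]; last by case.
by have [k [[_ mg] _ _ _ _]] := Nm; rewrite -(mg _ ma) -(mh _ ma).
Qed.

Hypotheses (Xetale : etale X) (Xbool : boolean_space (Obj X))
  (Xhaus : hausdorff_groupoid X).
Local Notation cA := (conv_assoc Xetale Xbool Xhaus).
Local Ltac gal :=
  by repeat first [assumption | apply: (galg_conv Xetale Xbool Xhaus)].

Lemma galg_part_conv g h f k : galg_part R X g f -> galg_part R X h k ->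
  galg_part R X (g * h)%g (f ** k).
Proof.
move=> [gf fg] [gk kh]; split; first by gal.
by move=> c /conv_supp; exact: homogeneous_set_gmul.
Qed.

(** Inserting a diagonal local unit between the two factors turns each product into a conjugate of a
    diagonal element. *)
Lemma normalizing_pair_diagonal g m m' : normalizing_pair g m m' ->
  D (m ** m') /\ D (m' ** m).
Proof.
move=> [[gm _] [gm' _] _ _ H].
have [e De em] := galg_local_unit Xetale Xhaus gm.
have [e' De' em'] := galg_local_unit Xetale Xhaus gm'.
have [ge _] := De; have [ge' _] := De'.
split; first by rewrite -em' cA//; have [] := H _ De'.
by rewrite -em cA//; have [] := H _ De.
Qed.

(** The diagonal elements [m' ** m] and [n ** n'] commute, which makes the reversed product of
    inverses an inverse; the conjugations nest. *)
Lemma normalizing_pair_conv g h m m' n n' :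
  normalizing_pair g m m' -> normalizing_pair h n n' ->
  normalizing_pair (g * h)%g (m ** n) (n' ** m').
Proof.
move=> pm pn; have [Dm Dm'] := normalizing_pair_diagonal pm.
have [Dn Dn'] := normalizing_pair_diagonal pn.
have [[gm _] [gm' _] em em' Hm] := pm; have [[gn _] [gn' _] en en' Hn] := pn.
have C := diagonal_convC Dm' Dn.
split.
- by case: pm pn => [? _ _ _ _] [? _ _ _ _]; exact: galg_part_conv.
- by rewrite invgM; case: pm pn => [_ ? _ _ _] [_ ? _ _ _]; exact: galg_part_conv.
- have -> : m ** n ** (n' ** m') ** (m ** n) = m ** (n ** n' ** (m' ** m)) ** n.
    by rewrite !cA; gal.
  rewrite -C.
  have -> : m ** (m' ** m ** (n ** n')) ** n = m ** m' ** m ** (n ** n' ** n).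
    by rewrite !cA; gal.
  by rewrite em en.
- have -> : n' ** m' ** (m ** n) ** (n' ** m') =
      n' ** (m' ** m ** (n ** n')) ** m' by rewrite !cA; gal.
  rewrite C.
  have -> : n' ** (n ** n' ** (m' ** m)) ** m' =
      n' ** n ** n' ** (m' ** m ** m') by rewrite !cA; gal.
  by rewrite em' en'.
- move=> f Df; have [gf _] := Df; split.
    have -> : m ** n ** f ** (n' ** m') = m ** (n ** f ** n') ** m'.
      by rewrite !cA; gal.
    by have [+ _] := Hn _ Df => /Hm[].
  have -> : n' ** m' ** f ** (m ** n) = n' ** (m' ** f ** m) ** n.
    by rewrite !cA; gal.
  by have [_] := Hm _ Df => /Hn[].
Qed.

(** As [e] is idempotent, [e'] is the product of the diagonal elements [e' ** e] and [e ** e'].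
    These are commuting idempotents, so [e'] is idempotent too, and then [e] is their product in the
    other order. *)
Lemma normalizer_idempotent e : elt N e -> e ** e = e -> D e.
Proof.
move=> [g _ [e' p]] ee; have [Dl Dr] := normalizing_pair_diagonal p.
have [[ge _] [ge' _] e1 e2 _] := p.
have e'E : e' = (e' ** e) ** (e ** e').
  by rewrite -[X in X = _]e2 -{1}ee !cA; gal.
have De' : D e' by rewrite e'E; exact: diagonal_conv.
have e'e' : e' ** e' = e'.
  have C := diagonal_convC Dl Dr; have [[gl _] [gr _]] := (Dl, Dr).
  have aa : e' ** e ** (e' ** e) = e' ** e by rewrite cA ?e2; gal.
  have bb : e ** e' ** (e ** e') = e ** e' by rewrite cA ?e1; gal.
  rewrite e'E; move: (e' ** e) (e ** e') C gl gr aa bb => a b C ga gb aa bb.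
  have -> : a ** b ** (a ** b) = a ** (b ** a) ** b by rewrite !cA; gal.
  rewrite C; have -> : a ** (a ** b) ** b = a ** a ** (b ** b).
    by rewrite !cA; gal.
  by rewrite aa bb.
have -> : e = (e ** e') ** (e' ** e).
  by rewrite -[X in X = _]e1 -{1}e'e' !cA; gal.
exact: diagonal_conv.
Qed.

Lemma normalizer_commuting_idempotents : commuting_idempotents N.
Proof.
move=> e f Ne Nf ee ff.
by apply: diagonal_convC; apply: normalizer_idempotent.
Qed.

Lemma diagonal0 : D (fun=> 0).
Proof.
have e : supp (fun=> 0 : R) = set0 :> set (Arr X).
  by apply/seteqP; split=> a // [].
split; last by rewrite e.
by split; [move=> a; exact: nearW|rewrite e; exact: compact0].
Qed.

Lemma normalizer_graded_inverse_semigroup : graded_inverse_semigroup N.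
Proof.
have NM m n : elt N m -> elt N n -> elt N (m ** n).
  move=> [g _ [m' pm]] [h _ [n' pn]].
  by have [] := normalizing_pair_elt (normalizing_pair_conv pm pn).
have gN m : elt N m -> galg m by move=> [g _ [m' [[? _] _ _ _ _]]].
have NA m n k : elt N m -> elt N n -> elt N k -> m ** (n ** k) = m ** n ** k.
  by move=> *; apply: cA; exact: gN.
split=> //.
- exists 1%g => //; exists (fun=> 0); have [g0 s0] := diagonal0.
  split; rewrite ?conv0l//.
  + by split=> // a [].
  + by split=> // a [].
  + by move=> f _; rewrite !conv0l; split; exact: diagonal0.
- by move=> m _; exact: conv0r.
- by move=> m _; exact: conv0l.
- move=> m Nm; have [g _ [m' p]] := Nm; have [_ Nm'] := normalizing_pair_elt p.
  apply: (@unique_inverse _ _ N NM NA _ m m') => //.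
  + exact: normalizer_commuting_idempotents.
  + by case: p.
  + by case: p.
- move=> m n [g _ Nm] [h _ Nn] mn0.
  have [m' pm] := Nm; have [n' pn] := Nn.
  rewrite (deg_normalizer _ Nm).
    rewrite (deg_normalizer _ Nn).
      apply: deg_normalizer => //; exists (n' ** m').
      exact: normalizing_pair_conv.
    by move=> n0; apply: mn0; rewrite n0 [LHS]conv0r.
  by move=> m0; apply: mn0; rewrite m0 [LHS]conv0l.
Qed.

Lemma normalizing_pair_unique g h m m1 m2 :
  normalizing_pair g m m1 -> normalizing_pair h m m2 -> m1 = m2.
Proof.
move=> p1 p2; have [Nm N1] := normalizing_pair_elt p1.
have [_ N2] := normalizing_pair_elt p2.
have [t [_ u]] := gis_inverse normalizer_graded_inverse_semigroup Nm.
have [_ _ e1 e1' _] := p1; have [_ _ e2 e2' _] := p2.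
by rewrite -(u m1)// -(u m2).
Qed.

(** The relation asks for some inverses; since inverses in the normalizer are unique, it can be
    tested on any given ones. *)
Lemma normalizer_simP g h m m' n n' :
  normalizing_pair g m m' -> normalizing_pair h n n' ->
  sim m n <-> m' ** m = n' ** n /\ D (m ** n').
Proof.
move=> pm pn; split=> [[m1 [n1 [[? pm1] [? pn1] e d]]]|[e d]].
  by rewrite (normalizing_pair_unique pm pm1) (normalizing_pair_unique pn pn1).
by exists m', n'; split=> //; [exists g|exists h].
Qed.

Lemma sim_convE g h m m' n n' :
  normalizing_pair g m m' -> normalizing_pair h n n' ->
  sim m n -> m = m ** n' ** n.
Proof.
move=> pm pn /(normalizer_simP pm pn)[e _].
have [[gm _] [gm' _] em _ _] := pm; have [[gn _] [gn' _] _ _ _] := pn.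
by rewrite -cA// -e cA.
Qed.

(** In [m = m ** n' ** n] the factor [m ** n'] is diagonal, so each value of [m] is a multiple of
    that of [n]. *)
Lemma supp_sim_sub m n : sim m n -> supp m `<=` supp n.
Proof.
move=> mn; have [m' [n' [[g pm] [h pn] _ [_ d]]]] := mn.
move=> c; apply: contra_not => nc0.
by rewrite (sim_convE pm pn mn) conv_diagl// nc0 mulr0.
Qed.

(** The point is that the inverse [d' = n ** m'] of the diagonal [d = m ** n'] is diagonal. Since
    [d] and [d ** d'] are diagonal, the identity [d' = d' ** (d ** d')] shows pointwise that [d']
    vanishes wherever [d' ** d] does, and the latter lives on units. *)
Lemma normalizer_sim_sym m n : sim m n -> sim n m.
Proof.
move=> mn; have [m' [n' [[g pm] [h pn] e d]]] := mn.
apply/(normalizer_simP pn pm); split=> //.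
have := normalizing_pair_conv pm (normalizing_pair_sym pn) => p.
have [[_ ddi] [_ d'di]] := normalizing_pair_diagonal p.
have [_ [gd' _] _ ed' _] := p; have [gd di] := d.
split=> // c nc; apply: d'di; rewrite /supp /= conv_diagr//.
move=> e0; apply: nc; rewrite -ed' -cA// conv_diagr//.
by rewrite (conv_diagl _ _ di) gran_id mulrA e0 mul0r.
Qed.

Lemma normalizer_sim_mul m n f k : sim m n -> sim f k -> sim (m ** f) (n ** k).
Proof.
move=> mn fk; have [m' [n' [[g pm] [h pn] e d]]] := mn.
have [f' [k' [[g1 pf] [h1 pk] e1 d1]]] := fk.
have pmf := normalizing_pair_conv pm pf.
apply/(normalizer_simP pmf (normalizing_pair_conv pn pk)).
have fE := sim_convE pf pk fk.
have [Dn _] := normalizing_pair_diagonal (normalizing_pair_sym pn).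
have [Dm _] := normalizing_pair_diagonal (normalizing_pair_sym pm).
have [[gm _] [gm' _] em _ Hm] := pm; have [[gn _] [gn' _] _ en _] := pn.
have [[gf _] [gf' _] _ _ _] := pf; have [[gk _] [gk' _] _ ek _] := pk.
have gfk' := galg_conv Xetale Xbool Xhaus gf gk'.
split; last first.
  (* Expanding [n'] as [n' ** n ** n'] and trading [n' ** n] for [m' ** m] exhibits a conjugate of
     the diagonal [f ** k'] times the diagonal [m ** n']. *)
  have -> : m ** f ** (k' ** n') = m ** (f ** k') ** m' ** (m ** n').
    rewrite -{1}en -e !cA; gal.
  by apply: diagonal_conv => //; have [] := Hm _ d1.
transitivity (f' ** (n' ** n) ** f).
  by rewrite -e !cA; gal.
(* Expand [f] as [f ** k' ** k] and move the diagonal [f ** k'] past [n' ** n]; then [f' ** f] can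
   be replaced by [k' ** k]. *)
transitivity (f' ** f ** k' ** (n' ** n) ** k).
  rewrite [X in _ ** X = _]fE.
  have -> : f' ** (n' ** n) ** (f ** k' ** k) = f' ** (n' ** n ** (f ** k')) ** k.
    by rewrite !cA; gal.
  rewrite (diagonal_convC Dn d1).
  by rewrite !cA; gal.
by rewrite e1 ek !cA; gal.
Qed.

Lemma normalizer_sim_congruence : graded_congruence N sim.
Proof.
split.
- move=> m [g _ [m' p]]; apply/(normalizer_simP p p); split=> //.
  by have [] := normalizing_pair_diagonal p.
- by move=> *; exact: normalizer_sim_sym.
- move=> m n k _ _ _ mn nk.
  have [m' [n' [[g pm] [h pn] e d]]] := mn.
  have [n1 [k' [[h1 pn1] [h2 pk] e1 d1]]] := nk.
  have n1E := normalizing_pair_unique pn1 pn; subst n1.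
  apply/(normalizer_simP pm pk); split; first by rewrite e.
  (* Replacing [m' ** m] by [n' ** n] in [m = m ** m' ** m] inserts the middle term and leaves a
     product of two diagonals. *)
  have -> : m ** k' = m ** n' ** (n ** k').
    have [[gm _] [gm' _] em _ _] := pm; have [[gn _] [gn' _] _ _ _] := pn.
    have [_ [gk' _] _ _ _] := pk.
    by rewrite -{1}em -[m ** m' ** m]cA// e !cA; gal.
  exact: diagonal_conv.
- by move=> *; exact: normalizer_sim_mul.
- move=> m _ m0; apply/funext => a; apply: contrapT => ma.
  by have [] := supp_sim_sub m0 ma.
- move=> m n [g _ Nm] [h _ Nn] m0 mn; have [m' [[_ mg] _ _ _ _]] := Nm.
  have [n' [[_ nh] _ _ _ _]] := Nn.
  have [a ma] : exists a, m a <> 0.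
    by apply: contra_notP m0 => /forallNP m0; apply/funext => a; exact: contrapT.
  have na := supp_sim_sub mn ma.
  rewrite (deg_normalizer m0 Nm) (@deg_normalizer h n _ Nn).
    by rewrite -(mg _ ma) -(nh _ na).
  by move=> n0; move: na; rewrite n0.
Qed.

(** * Indicators of bisections as normalizers, and the map [psi] *)

Lemma supp_indic (U : set (Arr X)) : (0 : R) <> 1 -> supp (\1_U : Arr X -> R) = U.
Proof.
move=> R01; apply/seteqP; split; first exact: supp_indic_sub.
by move=> a Ua; rewrite /supp /= indicE mem_set//; exact/nesym.
Qed.

Lemma normalizing_pair_indic g U : compact U -> local_bisection U ->
  U `<=` homogeneous_part X g ->
  normalizing_pair g (\1_U : Arr X -> R) \1_(@ginv X @^-1` U).
Proof.
move=> cU bU Ug; have bV := local_bisectionV bU.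
have cV := compactV cU; have Vg := homogeneousV Ug.
set V := _ @^-1` _ in bV cV Vg *; have [oU dU rU] := bU; have [oV dV rV] := bV.
have gU : galg \1_U by apply: galg_indic1.
have gV : galg \1_V by apply: galg_indic1.
(* Composable arrows [a] in [A] and [b] in [B] satisfy [b = ginv a], so their product is a unit.
   Taking [A] to be [U] and then [V] gives both halves of the normalizing condition. *)
have diag A B f : set_inj A (@gdom X) -> galg \1_A -> galg \1_B -> D f ->
    B = @ginv X @^-1` A -> D (\1_A ** f ** \1_B).
  move=> dA gA gB [gf fi] BA; split; first by gal.
  move=> _ /conv_supp[a [b [+ /supp_indic_sub Bb ab ->]]].
  rewrite /supp /= conv_diagr// => fa.
  have Aa : A a by apply: (@supp_indic_sub R X A) => a0; apply: fa; rewrite a0 mul0r.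
  have -> : b = ginv a.
    apply: (can_inj (@ginvK X)); rewrite ginvK; apply: dA; rewrite ?inE//.
      by move: Bb; rewrite BA.
    by rewrite gdom_inv.
  by exists (gran a); rewrite // gmulV.
split.
- by split=> // a /supp_indic_sub/Ug.
- by split=> // a /supp_indic_sub/Vg.
- rewrite !conv_indic1// set_gmulV//.
- by have := set_gmulV dV; rewrite set_ginvK !conv_indic1// => ->.
- by move=> f Df; split; apply: diag => //; rewrite set_ginvK.
Qed.

Lemma indic_elt U : elt (bisections X) U -> elt N (\1_U : Arr X -> R).
Proof.
move=> [[g Ug] cU bU].
by have [] := normalizing_pair_elt (normalizing_pair_indic cU bU Ug).
Qed.

Lemma psi_graded_hom :
  graded_hom (bisections X) (quotient N sim) (@psi G R X).
Proof.
have NG := normalizer_graded_inverse_semigroup.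
have NS := normalizer_sim_congruence.
split.
- by move=> U GU; exists \1_U => //; exact: indic_elt.
- move=> U V GU GV; rewrite mul_class//; try exact: indic_elt.
  by case: GV => _ _ [_ dV _]; rewrite /= conv_indic1.
- by rewrite /psi indic0.
- move=> U GU ne0; have U0 := class_neq0 (indic_elt GU) ne0.
  have NU := indic_elt GU; have [[g Ug] cU bU] := GU.
  rewrite deg_class// (deg_bisections (g := g))//.
    apply: deg_normalizer => //; exists \1_(@ginv X @^-1` U).
    exact: normalizing_pair_indic.
  by move=> UE; apply: U0; rewrite UE indic0.
Qed.

Lemma psi_inj U V : (0 : R) <> 1 -> elt (bisections X) U ->
  elt (bisections X) V -> @psi G R X U = @psi G R X V -> U = V.
Proof.
move=> R01 GU GV.
move=> /(class_eq normalizer_sim_congruence (indic_elt GU) (indic_elt GV)) UV.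
 rewrite -(supp_indic U R01) -(supp_indic V R01).
by apply/seteqP; split; apply: supp_sim_sub => //; exact: normalizer_sim_sym.
Qed.

Lemma supp_bisection g m m' : normalizing_pair g m m' ->
  local_bisection (supp m) -> elt (bisections X) (supp m).
Proof. by move=> [[[_ cm] mg] _ _ _ _] bm; split=> //; exists g. Qed.

(* [m' m] is an idempotent of the diagonal, hence takes the values 0 and 1 only
   when [R] is indecomposable. *)
Lemma sim_indic_supp g m m' : indecomposable R -> normalizing_pair g m m' ->
  local_bisection (supp m) -> sim \1_(supp m) m.
Proof.
move=> [R01 Ridem] p bm; have [[_ cm] mg] : galg_part R X g m by case: p.
have pU := normalizing_pair_indic cm bm mg.
have [_ [gd di]] := normalizing_pair_diagonal p.
have [[gm _] [gm' _] em em' _] := p; have [om dm rm] := bm.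
have [[gU _] _ _ _ _] := pU.
(* Read pointwise, [m = m ** (m' ** m)] says that [m] vanishes on every arrow whose domain unit is a
   zero of [m' ** m]. *)
have mE c : m c = m c * (m' ** m) (gid (gdom c)).
  by rewrite -{1}em -cA// conv_diagr.
apply: normalizer_sim_sym; apply/(normalizer_simP p pU); split.
  rewrite conv_indic1//; apply/funext => c.
  (* Both sides vanish off the units: [m' ** m] is diagonal, and injectivity of [gran] makes every
     product of an inverse with an element of [supp m] a unit. *)
  have [[x _ xc]|Nc] := pselect (range (@gid X) c); last first.
    rewrite indicE memNset; last first.
      move=> [a [b [/= Ua Ub ab cE]]]; apply: Nc; exists (gdom b) => //.
      suff aE : a = ginv b by rewrite cE aE gVmul.
      by apply: (can_inj (@ginvK X)); rewrite ginvK; apply: rm;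
        rewrite ?inE// gran_inv.
    by apply: contrapT => /di.
  subst c; have [mm1|mm0] : (m' ** m) (gid x) = 1 \/ (m' ** m) (gid x) = 0.
    have : (m' ** m ** (m' ** m)) (gid x) = (m' ** m) (gid x).
      by rewrite cA// ?em'//; gal.
    by rewrite conv_diagr// gdom_id => /Ridem[]; [right|left].
  + have mmx : supp (m' ** m) (gid x) by rewrite /supp /= mm1; exact/nesym.
    (* A nonzero value of [m' ** m] at the unit of [x] produces an arrow [b] of [supp m] with domain
       [x]. *)
    have [a [b [_ mb ab e]]] := conv_supp mmx.
    rewrite mm1 indicE mem_set//; exists (ginv b), b.
    rewrite gdom_inv gVmul /= ginvK; split=> //.
    by rewrite -[x]gdom_id e gdom_mul.
  + rewrite mm0 indicE memNset// => -[a [b [/= _ Ub ab e]]]; apply: Ub.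
    by rewrite mE -(gdom_mul ab) -e gdom_id mm0 mulr0.
have [_ [gV _] _ _ _] := pU; split; first by gal.
(* Here [a] and [ginv b] lie in [supp m] and share their domain, so the product is a unit. *)
move=> _ /conv_supp[a [b [ma /supp_indic_sub Vb ab ->]]].
suff -> : b = ginv a by exists (gran a); rewrite // gmulV.
apply: (can_inj (@ginvK X)); rewrite ginvK; apply: dm; rewrite ?inE//.
by rewrite gdom_inv.
Qed.

Lemma psi_graded_iso : indecomposable R ->
  graded_iso (bisections X) (quotient N sim) (@psi G R X) <->
  local_bisection_hypothesis R X.
Proof.
move=> Rind; have [R01 _] := Rind; have NS := normalizer_sim_congruence.
have Gis := bisections_graded_inverse_semigroup Xetale Xbool.
split=> [[_ [phi' [hphi' _ phi'K]]] m Nm|LBH].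
  (* The bisection that [phi'] assigns to the class of [m] has an indicator equivalent to [m], so it
     equals [supp m]. *)
  have Qm : elt (quotient N sim) (class N sim m) by exists m.
  have GU := ghom_elt hphi' Qm; have [_ _ bU] := GU.
  have /(class_eq NS (indic_elt GU) Nm) Um := phi'K _ Qm.
  suff -> : supp m = phi' (class N sim m) by [].
  rewrite -[RHS](supp_indic _ R01); apply/seteqP; split.
    by apply: supp_sim_sub; exact: normalizer_sim_sym.
  exact: supp_sim_sub.
apply: bijective_graded_iso.
- exact: (gis_zero Gis).
- exact: (gis_mul Gis).
- exact: psi_graded_hom.
- by move=> U V GU GV; exact: psi_inj.
- move=> _ [m Nm <-]; have bm := LBH m Nm; have [g _ [m' p]] := Nm.
  have GU := supp_bisection p bm; exists (supp m) => //.
  apply/(class_eq NS (indic_elt GU) Nm).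
  exact: sim_indic_supp p bm.
Qed.

End Normalizer.

Theorem proposition5p3 (G : groupType) (R : comPzRingType)
    (X : gradedGroupoid G) :
  indecomposable R -> ample X -> hausdorff_groupoid X ->
  let Gam := bisections X in
  let N := normalizer R X in
  let sim := @normalizer_sim G R X in
  [/\ graded_inverse_semigroup Gam,
      graded_inverse_semigroup N,
      graded_congruence N sim
    & graded_inverse_semigroup (quotient N sim)] /\
  [/\ graded_hom Gam (quotient N sim) (@psi G R X),
      set_inj (elt Gam) (@psi G R X)
    & graded_iso Gam (quotient N sim) (@psi G R X) <->
      local_bisection_hypothesis R X].
Proof.
move=> Rind [Xetale Xbool] Xhaus /=; have [R01 _] := Rind; split; split.
- exact: bisections_graded_inverse_semigroup.
- exact: normalizer_graded_inverse_semigroup.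
- exact: normalizer_sim_congruence.
- apply: quotient_graded_inverse_semigroup.
  + exact: normalizer_graded_inverse_semigroup.
  + exact: normalizer_sim_congruence.
  + exact: normalizer_commuting_idempotents.
- exact: psi_graded_hom.
- by move=> U V /set_mem GU /set_mem GV; exact: psi_inj.
- exact: psi_graded_iso.
Qed.
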